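(* Let $l\ge 0$ and $n\ge 1$ be integers. The Lie superalgebra $\mathfrak{spo}(2l+2|n)$ is contained in the intersection of the Lie superalgebra $\mathcal{K}(2l+1|n)$ of contact vector fields and the Lie superalgebra $\mathfrak{pgl}(2l+2|n)$ of projective vector fields on $\mathbb{R}^{2l+1|n}$. That is, with $\iota:\mathfrak{spo}(2l+2|n)\to\mathfrak{pgl}(2l+2|n)$, $A\mapsto[A]$, and $\Phi:\mathfrak{pgl}(2l+2|n)\to\mathrm{Vect}(\mathbb{R}^{2l+1|n})$ the projective embedding, $$\Phi\big(\iota(\mathfrak{spo}(2l+2|n))\big)\subset\mathcal{K}(2l+1|n)\cap\Phi\big(\mathfrak{pgl}(2l+2|n)\big).$$
   Context: Superspace: $C^\infty(\mathbb{R}^{2l+1|n})=C^\infty(\mathbb{R}^{2l+1})\otimes\Lambda\mathbb{R}^n$ is the real supercommutative superalgebra of superfunctions, with even coordinates $z,x_1,\dots,x_l,y_1,\dots,y_l$ and odd coordinates $\theta_1,\dots,\theta_n$ ($\theta_i\theta_j=-\theta_j\theta_i$). A tilde denotes parity. $\mathrm{Vect}(\mathbb{R}^{2l+1|n})$ is the Lie superalgebra of superderivations of $C^\infty(\mathbb{R}^{2l+1|n})$, with bracket $[X,Y]=XY-(-1)^{\tilde{X}\tilde{Y}}YX$ on homogeneous elements; a vector field is written $X=X^z\partial_z+\sum_i(X^{x_i}\partial_{x_i}+X^{y_i}\partial_{y_i})+\sum_jX^{\theta_j}\partial_{\theta_j}$ with coefficients on the left. Contact vector fields: the contact form is $\alpha=dz+\sum_{i=1}^l(x_idy_i-y_idx_i)+\sum_{j=1}^n\theta_jd\theta_j$,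 with evaluation (in the sign conventions used, where $\langle\partial_{\theta_j},d\theta_i\rangle=-\delta_{ij}$) $\alpha(X)=X^z+\sum_i(x_iX^{y_i}-y_iX^{x_i})+\sum_jX^{\theta_j}\theta_j$. $\mathrm{Tan}(\mathbb{R}^{2l+1|n})$ is the set of vector fields $X$ with $\alpha(X)=0$. $\mathcal{K}(2l+1|n)$ is the set of vector fields $X$ (contact vector fields) with $[X,T]\in\mathrm{Tan}(\mathbb{R}^{2l+1|n})$ for all $T\in\mathrm{Tan}(\mathbb{R}^{2l+1|n})$. The Lie superalgebra $\mathfrak{spo}(2l+2|n)$: let $\mathbb{R}^{2l+2|n}$ be the super vector space with even part $\mathbb{R}^{2l+2}$ and odd part $\mathbb{R}^n$, $J=\begin{pmatrix} 0 & -\mathrm{id}_{l+1} \\ \mathrm{id}_{l+1} & 0 \end{pmatrix}$, $G=\begin{pmatrix} J & 0 \\ 0 & \mathrm{id}_n \end{pmatrix}$ and $\omega(U,V)=V^tGU$. Then $\mathfrak{spo}(2l+2|n)$ is the set of $A\in\mathfrak{gl}(2l+2|n)$ with $\omega(AU,V)+(-1)^{\tilde{A}\tilde{U}}\omega(U,AV)=0$ for all $U,V\in\mathbb{R}^{2l+2|n}$ (for homogeneous $A,U$, extended by linearity). Projective embedding: $\mathfrak{pgl}(2l+2|n)=\mathfrak{gl}(2l+2|n)/\mathbb{R}\,\mathrm{Id}$, and $[A]$ is the class of $A$. Every class has a unique representative with zero $(1,1)$ entry, written $\begin{pmatrix} 0 & \xi \\ v & B \end{pmatrix}$ with $v\in\mathbb{R}^{2l+1|n}$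 (column), $\xi\in(\mathbb{R}^{2l+1|n})^*$ (row), $B=(B^i_j)\in\mathfrak{gl}(2l+1|n)$ ($i$ the row index, $j$ the column index). Let $t^1,\dots,t^{2l+1+n}$ denote, in this order, the coordinates $x_1,\dots,x_l,z,y_1,\dots,y_l,\theta_1,\dots,\theta_n$, and let $\tilde{i}$ be the parity of $t^i$. Then $$\Phi\left(\left[\begin{pmatrix} 0 & \xi \\ v & B \end{pmatrix}\right]\right)=-\sum_{i}v^i\partial_{t^i}-\sum_{i,j}(-1)^{\tilde{j}(\tilde{i}+\tilde{j})}B^i_jt^j\partial_{t^i}+\sum_{i,j}(-1)^{\tilde{j}}\xi_jt^jt^i\partial_{t^i},$$ all sums running from $1$ to $2l+1+n$. $\Phi$ is an injective Lie superalgebra homomorphism, and elements of its image are called projective vector fields. *)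

(* Defs.v *)
From HB Require Import structures.
From mathcomp Require Import all_boot all_order all_algebra.
From mathcomp Require Import generic_quotient ring_quotient.
From mathcomp Require Import all_classical all_reals all_analysis.

Set Implicit Arguments.
Unset Strict Implicit.
Unset Printing Implicit Defensive.

Import Order.TTheory GRing.Theory Num.Theory.
Import numFieldNormedType.Exports.

Local Open Scope ring_scope.

Section Smooth.
Variables (R : realType) (m : nat).
Implicit Types f g : 'rV[R]_m -> R.

Definition partial (i : 'I_m) f : 'rV[R]_m -> R :=
  fun x => 'D_(delta_mx 0 i) f x.

(* Ck k f : the partial derivatives of f of order at most k exist everywhere and
   are continuous. *)
Fixpoint Ck (k : nat) f : Prop :=
  if k is k'.+1 then
    continuous f /\
    forall i : 'I_m,
      (forall x, derivable f x (delta_mx 0 i)) /\ Ck k' (partial i f)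
  else continuous f.

Definition smooth f : Prop := forall k, Ck k f.

Definition is_smooth : {pred 'rV[R]_m -> R} := fun f => `[< smooth f >].

Lemma CkW k f : Ck k.+1 f -> Ck k f.
Proof.
elim: k f => [|k IH] f; first by case.
move=> [cf df]; split=> // i; have [dfi Cf] := df i.
by split=> //; exact: IH.
Qed.

Lemma Ck_cst k (c : R) : Ck k (cst c).
Proof.
elim: k c => [|k IH] c; first exact: cst_continuous.
split=> [|i]; first exact: cst_continuous.
split=> [x|]; first exact: derivable_cst.
suff -> : partial i (cst c) = cst 0 by exact: IH.
by apply/funext => x; rewrite /partial derive_cst.
Qed.

Lemma CkD k f g : Ck k f -> Ck k g -> Ck k (f + g).
Proof.
elim: k f g => [|k IH] f g /=.
  by move=> cf cg x; apply: continuousD; [exact: cf|exact: cg].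
move=> [cf df] [cg dg]; split.
  by move=> x; apply: continuousD; [exact: cf|exact: cg].
move=> i; have [dfi Cf] := df i; have [dgi Cg] := dg i.
split=> [x|]; first exact: derivableD.
suff -> : partial i (f + g) = partial i f + partial i g by exact: IH.
by apply/funext => x; rewrite /partial deriveD.
Qed.

Lemma CkM k f g : Ck k f -> Ck k g -> Ck k (f * g).
Proof.
elim: k f g => [|k IH] f g.
  by move=> cf cg x; apply: continuousM; [exact: cf|exact: cg].
move=> Cf Cg; have Cf' := CkW Cf; have Cg' := CkW Cg.
case: Cf Cg => [cf df] [cg dg]; split.
  by move=> x; apply: continuousM; [exact: cf|exact: cg].
move=> i; have [dfi Cfi] := df i; have [dgi Cgi] := dg i.
split=> [x|]; first exact: derivableM.
suff -> : partial i (f * g) = f * partial i g + g * partial i f.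
  by apply: CkD; exact: IH.
by apply/funext => x; rewrite /partial deriveM.
Qed.

Lemma smooth_partial i f : smooth f -> smooth (partial i f).
Proof. by move=> sf k; case: (sf k.+1) => _ /(_ i)[]. Qed.

Lemma is_derive_coord (i j : 'I_m) (x : 'rV[R]_m) :
  is_derive x (delta_mx 0 i : 'rV[R]_m) (fun y : 'rV[R]_m => y 0 j)
    ((i == j)%:R : R).
Proof.
have dc := differentiable_coord x 0 j.
apply: DeriveDef; first exact: diff_derivable.
rewrite deriveE //.
have lin : linear (fun y : 'rV[R]_m => y 0 j) by move=> k u v; rewrite !mxE.
pose F := GRing.isLinear.Build _ _ _ _ _ lin.
pose f : {linear 'rV[R]_m -> R} := HB.pack (fun y : 'rV[R]_m => y 0 j) F.
have -> : (fun y : 'rV[R]_m => y 0 j) = f by [].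
rewrite diff_lin; last exact: coord_continuous.
by rewrite /= mxE eqxx eq_sym.
Qed.

Lemma smooth_coord (j : 'I_m) : smooth (fun x => x 0 j).
Proof.
have cc : continuous (fun x : 'rV[R]_m => x 0 j) by exact: coord_continuous.
move=> [//|k]; split=> // i.
have dc := is_derive_coord i j.
split=> [x|]; first exact: ex_derive.
suff -> : partial i (fun x => x 0 j) = cst (i == j)%:R by exact: Ck_cst.
by apply/funext => x; rewrite /partial derive_val.
Qed.

Lemma smooth_subring_closed : subring_closed is_smooth.
Proof.
split=> [|f g /asboolP sf /asboolP sg|f g /asboolP sf /asboolP sg]; apply/asboolP.
- by move=> k; exact: Ck_cst.
- move=> k; apply: CkD; first exact: sf.
  by rewrite -mulN1r; apply: CkM; [exact: (Ck_cst k (-1))|exact: sg].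
- by move=> k; exact: CkM.
Qed.

HB.instance Definition _ :=
  GRing.isSubringClosed.Build _ is_smooth smooth_subring_closed.

Lemma smooth_scaler_closed : GRing.scaler_closed is_smooth.
Proof.
move=> c f /asboolP sf; apply/asboolP => k.
have -> : c *: f = cst c * f by [].
by apply: CkM; [exact: Ck_cst|exact: sf].
Qed.

HB.instance Definition _ :=
  GRing.isScaleClosed.Build R _ is_smooth smooth_scaler_closed.

Record Cinf := MkCinf { Cinf_val :> 'rV[R]_m -> R; _ : Cinf_val \in is_smooth }.

HB.instance Definition _ := [isSub for Cinf_val].
HB.instance Definition _ := [Choice of Cinf by <:].
HB.instance Definition _ := [SubChoice_isSubComNzRing of Cinf by <:].
HB.instance Definition _ := [SubZmodule_isSubLmodule of Cinf by <:].

Lemma partial_smooth (i : 'I_m) (f : Cinf) : partial i f \in is_smooth.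
Proof.
by have /asboolP sf := valP f; apply/asboolP; exact: smooth_partial.
Qed.

Lemma coord_smooth (i : 'I_m) : (fun x : 'rV[R]_m => x 0 i) \in is_smooth.
Proof. by apply/asboolP; exact: smooth_coord. Qed.

Definition dCinf (i : 'I_m) (f : Cinf) : Cinf := MkCinf (partial_smooth i f).

Definition coordCinf (i : 'I_m) : Cinf := MkCinf (coord_smooth i).

Lemma dCinf_coord (i j : 'I_m) : dCinf i (coordCinf j) = (i == j)%:R.
Proof.
apply/val_inj/funext => x /=; rewrite /partial.
have dc := is_derive_coord i j x; rewrite derive_val.
by case: (i == j).
Qed.

Lemma dCinf0 (i : 'I_m) : dCinf i 0 = 0.
Proof. by apply/val_inj/funext => x /=; exact: derive_cst. Qed.

Lemma dCinf1 (i : 'I_m) : dCinf i 1 = 0.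
Proof. by apply/val_inj/funext => x /=; exact: derive_cst. Qed.

End Smooth.

Section Superspace.
Variables (R : realType) (m n : nat).

(* The superfunction f stands for the sum over I of f I * theta_I, where
   theta_I = theta_i1 ... theta_ik for I = {i1 < ... < ik}. The product of
   superfunctions is smul, not the pointwise product inherited from {ffun _}. *)
Definition superfun := {ffun {set 'I_n} -> Cinf R m}.

HB.instance Definition _ := GRing.Lmodule.on superfun.

Definition operator := superfun -> superfun.

HB.instance Definition _ := GRing.Lmodule.on operator.

(* theta_I * theta_J = (-1) ^ inversions I J * theta_(I :|: J) for disjoint
   I and J. *)
Definition inversions (I J : {set 'I_n}) : nat :=
  #|[set p : 'I_n * 'I_n | [&& p.1 \in I, p.2 \in J & (p.2 < p.1)%N]]|.

Definition smul (f g : superfun) : superfun :=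
  [ffun K : {set 'I_n} => \sum_(I : {set 'I_n} | I \subset K)
     (-1) ^+ inversions I (K :\: I) * (f I * g (K :\: I))].

Definition homog (p : bool) (f : superfun) : Prop :=
  forall I : {set 'I_n}, odd #|I| != p -> f I = 0.

Definition hpart (p : bool) (f : superfun) : superfun :=
  [ffun I : {set 'I_n} => if odd #|I| == p then f I else 0].

(* The coordinates are indexed by 'I_(m + n), the even ones first. *)
Definition coord (i : 'I_(m + n)) : superfun :=
  match fintype.split i with
  | inl a => [ffun K : {set 'I_n} => if K == finset.set0 then coordCinf R a else 0]
  | inr j => [ffun K : {set 'I_n} => if K == [set j] then 1 else 0]
  end.

Definition coord_par (i : 'I_(m + n)) : bool := (m <= i)%N.

(* The odd partial derivatives are left derivatives. *)
Definition pd (i : 'I_(m + n)) : operator := fun f =>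
  match fintype.split i with
  | inl a => [ffun K : {set 'I_n} => dCinf a (f K)]
  | inr j => [ffun K : {set 'I_n} => if j \in K then 0
                else (-1) ^+ inversions [set j] K * f (j |: K)]
  end.

(* The coefficients of a vector field are its values on the coordinates. *)
Lemma coefE (X : operator) (c : 'I_(m + n) -> superfun) :
  (forall f, X f = \sum_i smul (c i) (pd i f)) -> forall j, X (coord j) = c j.
Proof.
have pd_coord i j :
    pd i (coord j) = [ffun K => if K == finset.set0 then (i == j)%:R else 0].
  have -> : (i == j) = (unsplit (fintype.split i) == unsplit (fintype.split j)).
    by rewrite !splitK.
  rewrite /pd /coord.
  case: (fintype.split i) => a; case: (fintype.split j) => b;
    apply/ffunP => K; rewrite !ffunE /=.
  - rewrite (inj_eq (@lshift_inj _ _)).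
    by case: ifP => _; [exact: dCinf_coord|exact: dCinf0].
  - rewrite eq_lrshift !if_same.
    by case: ifP => _; [exact: dCinf1|exact: dCinf0].
  - rewrite eq_rlshift if_same; case: ifP => // _.
    rewrite ifF ?mulr0 //.
    by apply/negbTE/set0Pn; exists a; rewrite setU11.
  - rewrite (inj_eq (@rshift_inj _ _)).
    have [->|K0] := eqVneq K finset.set0.
      rewrite !inE /= finset.setU0 (inj_eq (@finset.set1_inj _)) /inversions.
      rewrite (_ : [set p | _] = finset.set0) ?cards0 ?expr0 ?mul1r.
        by case: (a == b).
      by apply/setP => p; rewrite !inE andbF.
    case: ifPn => // aK; rewrite ifF ?mulr0 //.
    apply: contraNF K0 => /eqP aKb; rewrite -finset.subset0; apply/fintype.subsetP => k kK.
    have : k \in [set b] by rewrite -aKb setU1r.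
    rewrite inE => /eqP kb.
    have : a \in [set b] by rewrite -aKb setU11.
    by rewrite inE => /eqP ab; rewrite ab -kb kK in aK.
move=> Xc j; rewrite Xc; apply/ffunP => K; rewrite sum_ffunE (bigD1 j) //=.
rewrite [X in _ + X]big1 ?addr0 => [|i ij].
  rewrite ffunE (bigD1 K) //= big1 ?addr0 => [|I /andP[IK neq]].
    rewrite pd_coord ffunE finset.setDv !eqxx mulr1 /inversions.
    rewrite (_ : [set p | _] = finset.set0) ?cards0 ?expr0 ?mul1r //.
    by apply/setP => p; rewrite !inE andbF.
  rewrite pd_coord ffunE ifF ?mulr0 //.
  apply: contraNF neq; rewrite finset.setD_eq0 => KI.
  by rewrite finset.eqEsubset IK.
rewrite ffunE big1 // => I _.
by rewrite pd_coord ffunE (negbTE ij) if_same !mulr0.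
Qed.

Definition fmul (f : superfun) (X : operator) : operator :=
  fun g => smul f (X g).

Definition opart (p : bool) (X : operator) : operator :=
  fun f => \sum_(q : bool) hpart (p (+) q) (X (hpart q f)).

Definition superderivation (p : bool) (D : operator) : Prop :=
  [/\ linear D,
      forall q f, homog q f -> homog (p (+) q) (D f) &
      forall q f g, homog q f ->
        D (smul f g) = smul (D f) g + (-1) ^+ (p && q) *: smul f (D g)].

Definition Vect : set operator :=
  [set X | linear X /\ forall p, superderivation p (opart p X)]%classic.

(* The supercommutator, extended bilinearly from the homogeneous operators. *)
Definition bracket (X Y : operator) : operator :=
  \sum_(p : bool) \sum_(q : bool)
    (opart p X \o opart q Y - (-1) ^+ (p && q) *: (opart q Y \o opart p X)).

End Superspace.

Section Projective.
Variables (R : realType) (m n : nat).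

(* gl(m + 1 | n); columns and rows of index < 1 + m are even. *)
Definition gl : Type := 'M[R]_(1 + (m + n)).

HB.instance Definition _ := GRing.Lmodule.on gl.

Definition scalar_gl : {pred gl} := fun A => is_scalar_mx A.

Lemma scalar_gl_zmod_closed : zmod_closed scalar_gl.
Proof.
split=> [|_ _ /is_scalar_mxP[a ->] /is_scalar_mxP[b ->]]; apply/is_scalar_mxP.
  by exists 0; rewrite raddf0.
by exists (a - b); rewrite raddfB.
Qed.

HB.instance Definition _ :=
  GRing.isZmodClosed.Build gl scalar_gl scalar_gl_zmod_closed.

Definition pgl : Type := Quotient.quot scalar_gl.

HB.instance Definition _ := GRing.Zmodule.on pgl.
HB.instance Definition _ := EqQuotient.on pgl.

Definition pgl_class (A : gl) : pgl := (\pi_pgl A)%qT.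

(* The representative of a class with zero top left entry, see pgl_rep00,
   pgl_repK and pgl_repE. *)
Definition pgl_rep (c : pgl) : gl :=
  let A : gl := repr c in A - (A 0 0)%:M.

Lemma pgl_rep00 c : pgl_rep c 0 0 = 0.
Proof. by rewrite !mxE eqxx subrr. Qed.

Lemma pgl_repK : cancel pgl_rep pgl_class.
Proof.
move=> c; rewrite -[RHS]reprK; apply/eqP.
rewrite -Quotient.idealrBE /pgl_rep addrAC subrr add0r -raddfN.
exact: scalar_mx_is_scalar.
Qed.

Lemma pgl_repE (A : gl) : pgl_rep (pgl_class A) = A - (A 0 0)%:M.
Proof.
rewrite /pgl_rep /=; set A' : gl := repr _.
have : scalar_gl (A - A').
  by have := Quotient.idealrBE scalar_gl A A'; rewrite /A' reprK eqxx.
move=> /is_scalar_mxP[a AA'].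
have -> : A = A' + a%:M :> 'M[R]_(1 + (m + n)) by rewrite -AA' addrC subrK.
by rewrite !mxE eqxx mulr1n raddfD /= opprD addrACA subrr addr0.
Qed.

Definition Phi (c : pgl) : operator R m n :=
  let A : 'M[R]_(1 + (m + n)) := pgl_rep c in
  let v : 'cV[R]_(m + n) := dlsubmx A in
  let xi : 'rV[R]_(m + n) := ursubmx A in
  let B : 'M[R]_(m + n) := drsubmx A in
  let t := @coord R m n in
  let d := @pd R m n in
  let par := @coord_par m n in
  - (\sum_i v i 0 *: d i)
  - (\sum_i \sum_j
       ((-1) ^+ (par j && (par i (+) par j)) * B i j) *: fmul (t j) (d i))
  + \sum_i \sum_j
       ((-1) ^+ par j * xi 0 j) *: fmul (smul (t j) (t i)) (d i).

End Projective.

Section Contact.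
Variables (R : realType) (l n : nat).
Local Notation dim0 := (l + (1 + l))%N.
Local Notation superfun := (superfun R dim0 n).
Local Notation operator := (operator R dim0 n).

(* The coordinates are ordered as x_1, ..., x_l, z, y_1, ..., y_l, theta_1, ...,
   theta_n. *)
Definition tx (i : 'I_l) : superfun := coord R (lshift n (lshift (1 + l) i)).
Definition tz : superfun := coord R (lshift n (rshift l (lshift l ord0))).
Definition ty (i : 'I_l) : superfun := coord R (lshift n (rshift l (rshift 1 i))).
Definition ttheta (j : 'I_n) : superfun := coord R (rshift dim0 j).

(* The coefficient of X along the coordinate t is X t, see coefE. *)
Definition alpha (X : operator) : superfun :=
  X tz + \sum_(i < l) (smul (tx i) (X (ty i)) - smul (ty i) (X (tx i)))
  + \sum_(j < n) smul (X (ttheta j)) (ttheta j).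

Definition Tan : set operator := [set X | Vect X /\ alpha X = 0]%classic.

Definition contact_fields : set operator :=
  [set X | Vect X /\ forall T, Tan T -> Tan (bracket X T)]%classic.

Definition spo_J : 'M[R]_((1 + l) + (1 + l)) := block_mx 0 (- 1%:M) 1%:M 0.

(* (1 + l) + (1 + l) + n and 1 + (dim0 + n) are convertible. *)
Definition spo_G : 'M[R]_(1 + (dim0 + n)) :=
  (block_mx spo_J 0 0 1%:M : 'M[R]_((1 + l) + (1 + l) + n)).

Definition spo_omega (U V : 'cV[R]_(1 + (dim0 + n))) : R :=
  (V^T *m spo_G *m U) 0 0.

Definition gl_par (k : 'I_(1 + (dim0 + n))) : bool := (1 + dim0 <= k)%N.

Definition vpart (p : bool) (U : 'cV[R]_(1 + (dim0 + n))) :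
    'cV[R]_(1 + (dim0 + n)) :=
  \col_k (if gl_par k == p then U k 0 else 0).

Definition mxpart (p : bool) (A : 'M[R]_(1 + (dim0 + n))) :
    'M[R]_(1 + (dim0 + n)) :=
  \matrix_(h, k) (if gl_par h (+) gl_par k == p then A h k else 0).

(* The defining identity, extended by linearity to all A and U through their
   homogeneous components. *)
Definition spo : set (gl R dim0 n) :=
  [set A | forall U V : 'cV[R]_(1 + (dim0 + n)),
     \sum_(p : bool) \sum_(q : bool)
       (spo_omega (mxpart p A *m vpart q U) V
        + (-1) ^+ (p && q) * spo_omega (vpart q U) (mxpart p A *m V)) = 0]%classic.

Definition spo_to_pgl (A : gl R dim0 n) : pgl R dim0 n := pgl_class A.

End Contact.

Arguments spo R l n : clear implicits.
Arguments contact_fields R l n : clear implicits.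

(* Main.v *)
Require Import Defs.
From HB Require Import structures.
From mathcomp Require Import all_boot all_order all_algebra ring.
From mathcomp Require Import all_classical all_reals all_analysis.

(* With t^0 = 1 the projective field of A reads
     X t^k = F_0 t^k - F_k,  where F_k = sum_j (-1)^(j(k+j)) A_kj t^j,
   and alpha (Y) = sum_k (Y t^k) c_k, where c_k = sum_j G_kj t^j. For a
   homogeneous A of parity p, applying X to sum_k (T t^k) c_k = 0 turns
   alpha ([X, T]) into a sum of terms +- (T t^k) (sum_j G_kj F_j + sum_j A_jk c_j);
   the terms in F_0 cancel because sum_k t^k c_k = 0 and alpha (T) = 0. The
   coefficient of t^j in the last factor is (-1)^(jp) (G A)_kj + (A^T G)_kj, which
   vanishes exactly when A lies in spo. Since X is a quadratic polynomial field,
   T only ever has to be evaluated on polynomials, through T t^k. *)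

Set Implicit Arguments.
Unset Strict Implicit.
Unset Printing Implicit Defensive.

Import GRing.Theory Num.Theory.

(** * The superalgebra of superfunctions: associativity, unit, parity, supercommutativity *)

Section Grassmann.
Local Open Scope ring_scope.
Variables (R : realType) (m n : nat).
Local Notation superfun := (superfun R m n).
Implicit Types (I J K : {set 'I_n}) (f g h : superfun).

Lemma disjoint_setUl I J K :
  [disjoint (I :|: J)%SET & K] = [disjoint I & K] && [disjoint J & K].
Proof. by rewrite -!setI_eq0 finset.setIUl finset.setU_eq0. Qed.

(** As a double sum the sign exponent becomes additive in each argument over disjoint unions, which
    is what the sign computations rest on. *)
Lemma inversionsE I J :
  inversions I J = (\sum_(i in I) \sum_(j in J) (j < i))%N.
Proof.
rewrite /inversions -sum1_card pair_big_dep /=.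
rewrite [RHS](eq_bigr (fun p : 'I_n * 'I_n => if (p.2 < p.1)%N then 1 else 0)%N).
  rewrite -big_mkcondr; apply: eq_bigl => p; by rewrite inE andbA.
by move=> p _; case: (_ < _)%N.
Qed.

Lemma inversionsUl I J K : [disjoint I & J] ->
  inversions (I :|: J) K = (inversions I K + inversions J K)%N.
Proof.
by move=> dIJ; rewrite !inversionsE -bigU //; apply: eq_bigl => i; rewrite !inE.
Qed.

Lemma inversionsUr I J K : [disjoint J & K] ->
  inversions I (J :|: K) = (inversions I J + inversions I K)%N.
Proof.
move=> dJK; rewrite !inversionsE -big_split /=; apply: eq_bigr => i _.
by rewrite -bigU //; apply: eq_bigl => j; rewrite !inE.
Qed.

Lemma inversions0l J : inversions finset.set0 J = 0%N.
Proof. by rewrite inversionsE big_set0. Qed.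

Lemma inversions0r I : inversions I finset.set0 = 0%N.
Proof. by rewrite inversionsE big1 // => i _; rewrite big_set0. Qed.

(** By disjointness the two members of a pair in [I * J] differ, so the pair is an inversion in
    exactly one of the two orders. *)
Lemma inversionsC I J : [disjoint I & J] ->
  (inversions I J + inversions J I = #|I| * #|J|)%N.
Proof.
move=> dIJ; rewrite !inversionsE [X in (_ + X)%N]exchange_big -big_split /=.
rewrite -sum_nat_const; apply: eq_bigr => i iI.
rewrite -big_split -sum1_card /=; apply: eq_bigr => j jJ.
have : (i : nat) != j.
  apply: contraTneq dIJ => /val_inj ij.
  by apply/pred0Pn; exists i; rewrite /= iI ij jJ.
by case: ltngtP.
Qed.

(** The monomial [a * theta_I]. Superfunctions are finite sums of monomials, so additive identities
    need only be checked on them. *)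
Definition mono I (a : Cinf R m) : superfun :=
  [ffun K => if K == I then a else 0].

Lemma mono0 I : mono I 0 = 0.
Proof. by apply/ffunP => K; rewrite !ffunE if_same. Qed.

Lemma monoD I a b : mono I (a + b) = mono I a + mono I b.
Proof. by apply/ffunP => K; rewrite !ffunE; case: ifP => //; rewrite addr0. Qed.

Lemma monoZ I c a : mono I (c *: a) = c *: mono I a.
Proof. by apply/ffunP => K; rewrite !ffunE; case: ifP => //; rewrite scaler0. Qed.

Lemma superfun_sum f : f = \sum_I mono I (f I).
Proof.
apply/ffunP => K; rewrite sum_ffunE (bigD1 K) //= ffunE eqxx big1 ?addr0 // => I.
by rewrite ffunE eq_sym => /negbTE ->.
Qed.

Lemma homog_ind (p : bool) (P : superfun -> Prop) :
  P 0 -> (forall f g, P f -> P g -> P (f + g)) ->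
  (forall I a, odd #|I| = p -> P (mono I a)) ->
  forall f, homog p f -> P f.
Proof.
move=> P0 PD Pm f hf; rewrite (superfun_sum f); apply: big_ind => // I _.
by have [oI|/hf ->] := eqVneq (odd #|I|) p; [exact: Pm|rewrite mono0].
Qed.

Lemma superfun_ind (P : superfun -> Prop) :
  P 0 -> (forall f g, P f -> P g -> P (f + g)) ->
  (forall I a, P (mono I a)) -> forall f, P f.
Proof. by move=> P0 PD Pm f; rewrite (superfun_sum f); apply: big_ind. Qed.

Lemma smulDl : left_distributive (@smul R m n) +%R.
Proof.
move=> f g h; apply/ffunP => K; rewrite !ffunE -big_split /=.
by apply: eq_bigr => I _; rewrite ffunE mulrDl mulrDr.
Qed.

Lemma smulDr : right_distributive (@smul R m n) +%R.
Proof.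
move=> f g h; apply/ffunP => K; rewrite !ffunE -big_split /=.
by apply: eq_bigr => I _; rewrite ffunE !mulrDr.
Qed.

Lemma smul0l g : smul 0 g = 0.
Proof. by apply: (addrI (smul 0 g)); rewrite -smulDl !addr0. Qed.

Lemma smul0r f : smul f 0 = 0.
Proof. by apply: (addrI (smul f 0)); rewrite -smulDr !addr0. Qed.

Lemma Cinf_scalerAl (c : R) (a b : Cinf R m) : c *: (a * b) = c *: a * b.
Proof. by apply/val_inj/funext => x; exact: mulrA. Qed.

Lemma Cinf_scalerAr (c : R) (a b : Cinf R m) : c *: (a * b) = a * (c *: b).
Proof. by rewrite mulrC Cinf_scalerAl mulrC. Qed.

Lemma smulZl c f g : c *: smul f g = smul (c *: f) g.
Proof.
apply/ffunP => K; rewrite !ffunE scaler_sumr; apply: eq_bigr => I _.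
by rewrite ffunE Cinf_scalerAr Cinf_scalerAl.
Qed.

Lemma smulZr c f g : c *: smul f g = smul f (c *: g).
Proof.
apply/ffunP => K; rewrite !ffunE scaler_sumr; apply: eq_bigr => I _.
by rewrite ffunE Cinf_scalerAr Cinf_scalerAr.
Qed.

(** A generator occurring in both factors squares to zero; otherwise sorting the concatenated
    generators produces the sign. *)
Lemma smul_mono I J a b : smul (mono I a) (mono J b) =
  if [disjoint I & J] then mono (I :|: J) ((-1) ^+ inversions I J * (a * b))
  else 0.
Proof.
apply/ffunP => K; rewrite ffunE.
(* In the sum defining the product only the term indexed by [I] itself survives, and its second
   factor requires [K :\: I] to be [J]. *)
transitivity (if (I \subset K) && (K :\: I == J)%SET then
   (-1) ^+ inversions I J * (a * b) else 0).
  rewrite big_mkcond (bigD1 I) //= big1 ?addr0 => [|L /negbTE LI].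
    rewrite !ffunE eqxx; case: (I \subset K) => //=.
    by case: eqP => [->|]; rewrite ?mulr0.
  by rewrite !ffunE LI mul0r mulr0 if_same.
have -> : (I \subset K) && (K :\: I == J)%SET =
    [disjoint I & J] && (K == I :|: J)%SET.
  apply/andP/andP => -[].
    move=> IK /eqP <-; split; last first.
      rewrite finset.setDE finset.setUIr finset.setUCr finset.setIT.
      by rewrite (finset.setUidPr IK).
    by rewrite -setI_eq0 finset.setIDA finset.setDIl finset.setDv finset.set0I.
  rewrite -setI_eq0 => /eqP dIJ /eqP ->; rewrite finset.subsetUl; split => //.
  rewrite finset.setDUl finset.setDv finset.set0U finset.setDE; apply/eqP/finset.setIidPl.
  by rewrite finset.subsets_disjoint finset.setCK -setI_eq0 finset.setIC dIJ.
by case: ifP => [/andP[-> /eqP ->]|]; rewrite ?ffunE ?eqxx //;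
  case: [disjoint I & J] => /= [|_]; rewrite ffunE // => ->.
Qed.

(** On monomials both sides vanish as soon as two of the three sets meet. Otherwise both exponents
    are the sum of the inversions of [I, J], of [I, K] and of [J, K]. *)
Lemma smulA : associative (@smul R m n).
Proof.
move=> f g h.
elim/superfun_ind: f => [|f f' fP f'P|I a]; first by rewrite !smul0l.
  by rewrite !smulDl fP f'P.
elim/superfun_ind: g => [|g g' gP g'P|J b]; first by rewrite !(smul0l, smul0r).
  by rewrite !(smulDl, smulDr) gP g'P.
elim/superfun_ind: h => [|h h' hP h'P|K c]; first by rewrite !smul0r.
  by rewrite !smulDr hP h'P.
rewrite !smul_mono; case: ifP => [dJK|ndJK]; rewrite ?smul0r ?smul_mono; last first.
  by case: ifP; rewrite ?smul0l ?smul_mono // disjoint_setUl ndJK andbF.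
rewrite disjoint_sym disjoint_setUl ![[disjoint _ & I]]disjoint_sym.
case: ifP => [/andP[dIJ dIK]|nd]; last first.
  case: ifP nd => [/= dIJ dIK|]; rewrite ?smul0l ?smul_mono //.
  by rewrite disjoint_setUl dIK.
rewrite dIJ smul_mono disjoint_setUl dIK dJK finset.setUA /=; congr mono.
rewrite inversionsUl // inversionsUr // !exprD.
set x := (-1) ^+ _; set y := (-1) ^+ _; set z := (-1) ^+ _.
by rewrite -!mulrA [a * (z * _)]mulrCA [x * (y * _)]mulrCA [x * (z * _)]mulrCA.
Qed.

Definition sone : superfun := mono finset.set0 1.

Lemma smul1l : left_id sone (@smul R m n).
Proof.
elim/superfun_ind => [|f g fP gP|I a]; first by rewrite smul0r.
  by rewrite smulDr fP gP.
by rewrite smul_mono -setI_eq0 finset.set0I eqxx finset.set0U inversions0l !mul1r.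
Qed.

Lemma smul1r : right_id sone (@smul R m n).
Proof.
elim/superfun_ind => [|f g fP gP|I a]; first by rewrite smul0l.
  by rewrite smulDl fP gP.
by rewrite smul_mono -setI_eq0 finset.setI0 eqxx finset.setU0 inversions0r mul1r mulr1.
Qed.

(* Only the ring structure is declared: an algebra instance would be inferred for
   the pointwise product of {ffun _}, to which superfun unfolds. *)
HB.instance Definition _ := GRing.Zmodule_isPzRing.Build superfun
  smulA smul1l smul1r smulDl smulDr.

Lemma superfun_scaleAl (c : R) f g : c *: (f * g) = c *: f * g.
Proof. exact: smulZl. Qed.

Lemma superfun_scaleAr (c : R) f g : c *: (f * g) = f * (c *: g).
Proof. exact: smulZr. Qed.

Lemma smulE f g : smul f g = f * g. Proof. by []. Qed.

Lemma homog0 p : homog p (0 : superfun).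
Proof. by move=> I _; rewrite ffunE. Qed.

Lemma homogD p f g : homog p f -> homog p g -> homog p (f + g).
Proof. by move=> hf hg I Ip; rewrite ffunE hf ?hg ?addr0. Qed.

Lemma homogZ p c f : homog p f -> homog p (c *: f).
Proof. by move=> hf I Ip; rewrite ffunE hf ?scaler0. Qed.

Lemma homogN p f : homog p f -> homog p (- f).
Proof. by rewrite -scaleN1r; apply: homogZ. Qed.

Lemma homog_sum p (T : Type) (r : seq T) (P : pred T) (F : T -> superfun) :
  (forall i, P i -> homog p (F i)) -> homog p (\sum_(i <- r | P i) F i).
Proof. by move=> hF; apply: big_ind => //; [exact: homog0|exact: homogD]. Qed.

Lemma homog_mono I a : homog (odd #|I|) (mono I a).
Proof. by move=> J; rewrite ffunE; case: (J =P I) => // ->; rewrite eqxx. Qed.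

Lemma homogM p q f g : homog p f -> homog q g -> homog (p (+) q) (f * g).
Proof.
move=> hf; move: f hf q g; apply: homog_ind.
- by move=> q g _; rewrite mul0r; exact: homog0.
- by move=> f f' fP f'P q g hg; rewrite mulrDl; apply: homogD; [exact: fP|exact: f'P].
move=> I a <- q; apply: homog_ind.
- by rewrite mulr0; exact: homog0.
- by move=> g g' gP g'P; rewrite mulrDr; exact: homogD.
move=> J b <-; rewrite -smulE smul_mono; case: ifP => dIJ; last exact: homog0.
rewrite -oddD -cardsUI; move: dIJ; rewrite -setI_eq0 => /eqP ->.
by rewrite cards0 addn0; exact: homog_mono.
Qed.

Lemma homog1 : homog false (1 : superfun).
Proof. by have := homog_mono (I := finset.set0) 1; rewrite cards0. Qed.

Lemma sign_scale k (a : Cinf R m) : (-1) ^+ k * a = (-1) ^+ k *: a.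
Proof.
elim: k => [|k IH]; first by rewrite mul1r scale1r.
by rewrite !exprS !mulN1r mulNr IH scaleNr.
Qed.

(** On monomials the two signs differ by [(-1) ^+ (#|I| * #|J|)] according to [inversionsC], and the
    parities of the cardinals are [p] and [q]. *)
Lemma supercommute p q f g :
  homog p f -> homog q g -> f * g = (-1) ^+ (p && q) *: (g * f).
Proof.
move=> hf; move: f hf q g; apply: homog_ind.
- by move=> q g _; rewrite mul0r mulr0 scaler0.
- by move=> f f' fP f'P q g hg; rewrite mulrDl mulrDr scalerDr (fP q) ?(f'P q).
move=> I a <- q; apply: homog_ind.
- by rewrite mulr0 mul0r scaler0.
- by move=> g g' gP g'P; rewrite mulrDl mulrDr scalerDr gP g'P.
move=> J b <-; rewrite -!smulE !smul_mono disjoint_sym.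
case: ifP => dIJ; last by rewrite scaler0.
rewrite -monoZ finset.setUC; congr mono; rewrite !sign_scale mulrC scalerA; congr (_ *: _).
rewrite disjoint_sym in dIJ; rewrite -oddM signr_odd -inversionsC // exprD.
by rewrite -mulrA -expr2 sqrr_sign mulr1.
Qed.

Lemma homog_odd_sqr f : homog true f -> f * f = 0.
Proof.
move=> hf; have := supercommute hf hf; rewrite scaleN1r => /eqP.
(* Supercommutativity gives [f * f + f * f = 0]; writing [1] as the sum of two halves removes the
   factor two. *)
rewrite -addr_eq0 => /eqP E; rewrite -[LHS]scale1r (splitr 1) scalerDl -scalerDr.
by rewrite E scaler0.
Qed.

Lemma hpart_is_linear p : linear (@hpart R m n p).
Proof.
move=> c f g; apply/ffunP => I; rewrite !ffunE; case: ifP => //.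
by rewrite scaler0 addr0.
Qed.

HB.instance Definition _ p :=
  GRing.isLinear.Build R superfun superfun _ (@hpart R m n p) (hpart_is_linear p).

Lemma homog_hpart p f : homog p (hpart p f).
Proof. by move=> I /negbTE pI; rewrite ffunE pI. Qed.

Lemma hpartE p q f : homog p f -> hpart q f = if q == p then f else 0.
Proof.
move=> hf; apply/ffunP => I; rewrite ffunE; case: (eqVneq q p) => [->|qp].
  by case: eqVneq => // /hf.
rewrite [RHS]ffunE; case: eqVneq => // oI; apply: hf.
by rewrite oI.
Qed.

Lemma hpart_sum f : f = \sum_(p : bool) hpart p f.
Proof.
rewrite big_bool; apply/ffunP => I; rewrite !ffunE.
by case: (odd _); rewrite /= ?addr0 ?add0r.
Qed.

(** Multiplication by [g] shifts parity by [r], so the part of parity [q] of the product comes from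
    a single part of [f]. *)
Lemma hpart_mulr q r f g : homog r g -> hpart (q (+) r) f * g = hpart q (f * g).
Proof.
move=> hg; rewrite [in RHS](hpart_sum f) mulr_suml raddf_sum /=.
have hM p := homogM (@homog_hpart p f) hg.
rewrite (bigD1 (q (+) r)) //= big1 ?addr0 => [|p pq].
  by rewrite (hpartE _ (hM _)) -addbA addbb addbF eqxx.
by rewrite (hpartE _ (hM _)) ifF //; case: p q r pq {hg hM} => -[] [].
Qed.

End Grassmann.

(** * Partial derivatives: linearity, action on monomials, Leibniz rule for the even ones *)

Section Derivations.
Local Open Scope ring_scope.
Variables (R : realType) (m n : nat).
Local Notation superfun := (superfun R m n).
Local Notation operator := (operator R m n).
Implicit Types (I J K : {set 'I_n}) (f g h : superfun) (D X Y : operator).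

Section LinearOperator.
Variables (D : operator) (linD : linear D).

(** Operators are bare functions; packing [D] with its linearity gives access to the lemmas on
    additive maps. *)
Let L : {linear superfun -> superfun} :=
  HB.pack D (GRing.isLinear.Build _ _ _ _ _ linD).

Lemma opD f g : D (f + g) = D f + D g. Proof. exact: (raddfD L). Qed.
Lemma op0 : D 0 = 0. Proof. exact: (raddf0 L). Qed.
Lemma opZ c f : D (c *: f) = c *: D f.
Proof. by have := linD c f 0; rewrite op0 !addr0. Qed.
Lemma opN f : D (- f) = - D f. Proof. exact: (raddfN L). Qed.
Lemma op_sum (T : Type) (r : seq T) (P : pred T) (F : T -> superfun) :
  D (\sum_(i <- r | P i) F i) = \sum_(i <- r | P i) D (F i).
Proof. exact: (raddf_sum L). Qed.

End LinearOperator.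

Lemma sum_opE (T : Type) (r : seq T) (P : pred T) (F : T -> operator) f :
  (\sum_(i <- r | P i) F i) f = \sum_(i <- r | P i) F i f.
Proof. exact: (big_morph (fun X : operator => X f)). Qed.

Lemma dCinf_derivable i (a : Cinf R m) x : derivable a x (delta_mx 0 i).
Proof.
by have /asboolP sa := valP a; case: (sa 1%N) => _ /(_ i)[].
Qed.

Lemma dCinf_is_linear i : linear (@dCinf R m i).
Proof.
move=> c a b; apply/val_inj/funext => x /=.
have da := @dCinf_derivable i a x; have db := @dCinf_derivable i b x.
transitivity ('D_(delta_mx 0 i) (c \*: Cinf_val a + Cinf_val b) x) => //.
rewrite deriveD //; last exact: derivableZ.
by rewrite deriveZ.
Qed.

Lemma dCinfM i (a b : Cinf R m) :
  dCinf i (a * b) = dCinf i a * b + a * dCinf i b.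
Proof.
apply/val_inj/funext => x /=.
have da := @dCinf_derivable i a x; have db := @dCinf_derivable i b x.
transitivity ('D_(delta_mx 0 i) (Cinf_val a * Cinf_val b) x) => //.
rewrite deriveM // addrC; congr (_ + _); exact: mulrC.
Qed.

(** [pd_even] and [pd_odd] are the two branches of [pd], separated because their Leibniz rules
    differ by a sign. *)
Definition pd_even (a : 'I_m) : operator := fun f => [ffun K => dCinf a (f K)].

Definition pd_odd (j : 'I_n) : operator := fun f =>
  [ffun K : {set 'I_n} => if j \in K then 0
    else (-1) ^+ inversions [set j] K * f (j |: K)%SET].

Lemma pd_even_linear a : linear (pd_even a).
Proof.
by move=> c f g; apply/ffunP => K; rewrite !ffunE dCinf_is_linear.
Qed.

Lemma pd_odd_linear j : linear (pd_odd j).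
Proof.
move=> c f g; apply/ffunP => K; rewrite !ffunE; case: ifP => _.
  by rewrite scaler0 addr0.
by rewrite mulrDr Cinf_scalerAr.
Qed.

Lemma dCinfZ i c (a : Cinf R m) : dCinf i (c *: a) = c *: dCinf i a.
Proof. by have := dCinf_is_linear i c a 0; rewrite dCinf0 !addr0. Qed.

Lemma pd_even_mono a I b : pd_even a (mono I b) = mono I (dCinf a b).
Proof. by apply/ffunP => K; rewrite !ffunE; case: ifP; rewrite ?dCinf0. Qed.

Lemma pd_odd_mono j I (b : Cinf R m) : pd_odd j (mono I b) =
  if j \in I then mono (I :\ j)%SET ((-1) ^+ inversions [set j] (I :\ j) * b)
  else 0.
Proof.
case: ifPn => jI; apply/ffunP => K; rewrite !ffunE.
  have [->|KI] := eqVneq K (I :\ j)%SET.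
    by rewrite !inE eqxx /= finset.setD1K // eqxx.
  case: ifPn => // jK; rewrite ifF ?mulr0 //; apply: contraNF KI => /eqP <-.
  by rewrite finset.setU1K.
case: ifPn => // jK; rewrite ifF ?mulr0 //; apply: contraNF jI => /eqP <-.
exact: setU11.
Qed.

Lemma pd_evenM a f g : pd_even a (f * g) = pd_even a f * g + f * pd_even a g.
Proof.
have lin := pd_even_linear a.
elim/superfun_ind: f => [|f f' fP f'P|I b].
- by rewrite mul0r (op0 lin) !mul0r addr0.
- by rewrite mulrDl !(opD lin) mulrDl fP f'P mulrDl addrACA.
elim/superfun_ind: g => [|g g' gP g'P|J c].
- by rewrite mulr0 (op0 lin) !mulr0 addr0.
- by rewrite mulrDr !(opD lin) !mulrDr gP g'P addrACA.
rewrite !pd_even_mono -!smulE !smul_mono.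
case: ifP => _; last by rewrite (op0 lin) addr0.
by rewrite pd_even_mono -monoD !sign_scale -scalerDr -dCinfM dCinfZ.
Qed.

End Derivations.

(** * Odd Leibniz rule, superderivations, supercommutators, homogeneous parts of vector fields *)

Section Superderivations.
Local Open Scope ring_scope.
Variables (R : realType) (m n : nat).
Local Notation superfun := (superfun R m n).
Local Notation operator := (operator R m n).
Implicit Types (I J K : {set 'I_n}) (f g h : superfun) (D X Y : operator).

Lemma add_opE X Y f : (X + Y) f = X f + Y f. Proof. by []. Qed.

Lemma scale_opE c X f : (c *: X) f = c *: X f. Proof. by []. Qed.

Lemma signr_eq (T : pzRingType) (a b : nat) :
  odd a = odd b -> (-1) ^+ a = (-1) ^+ b :> T.
Proof. by move=> ab; rewrite -signr_odd ab signr_odd. Qed.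

(** The proof distinguishes which of [I] and [J] contain [j]. In every case the claim reduces to a
    congruence modulo 2 between numbers of inversions. *)
Lemma pd_odd_mono_mul j I J (a b : Cinf R m) :
  pd_odd j (mono I a * mono J b) =
  pd_odd j (mono I a) * mono J b + (-1) ^+ #|I| *: (mono I a * pd_odd j (mono J b)).
Proof.
have lin := @pd_odd_linear R m n j.
have djS K : [disjoint [set j] & K :\ j]%SET by rewrite disjoints1 !inE eqxx.
have DU (K L : {set 'I_n}) : j \notin L -> ((K :|: L) :\ j = K :\ j :|: L)%SET.
  move=> jL; rewrite finset.setDUl; congr (_ :|: _)%SET.
  by apply/finset.setDidPl; rewrite disjoint_sym disjoints1.
have dD (K L : {set 'I_n}) : j \in K -> j \notin L ->
    [disjoint K & L] = [disjoint K :\ j & L]%SET.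
  by move=> jK jL; rewrite -{1}(finset.setD1K jK) disjoint_setUl disjoints1 jL.
rewrite -[mono I a * mono _ _]smulE smul_mono !pd_odd_mono.
have [jI|jI] := boolP (j \in I); have [jJ|jJ] := boolP (j \in J); last first.
- rewrite mul0r mulr0 scaler0 addr0.
  by case: ifP => _; rewrite ?(op0 lin) // pd_odd_mono inE (negbTE jI) (negbTE jJ).
- rewrite mul0r add0r -smulE smul_mono disjoint_sym dD // disjoint_sym.
  case: ifPn => dIJ; last by rewrite (op0 lin) scaler0.
  rewrite pd_odd_mono inE jJ orbT finset.setUC DU // finset.setUC.
  rewrite -monoZ; congr mono; rewrite !sign_scale -!Cinf_scalerAr !scalerA; congr (_ *: _).
  (* Here [theta_j] has to be moved across all of [theta_I]: the sign [(-1) ^+ #|I|] counts the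
     inversions between [j] and [I] in both orders. *)
  have djI : [disjoint [set j] & I] by rewrite disjoints1.
  have := inversionsC djI; rewrite cards1 mul1n => <-.
  rewrite -{2}(finset.setD1K jJ) !inversionsUr // -!exprD; apply: signr_eq.
  by rewrite !oddD; do 4?case: (odd _).
- rewrite mulr0 scaler0 addr0 -[RHS]smulE smul_mono dD //.
  case: ifPn => dIJ; last by rewrite (op0 lin).
  rewrite pd_odd_mono inE jI DU //.
  congr mono; rewrite !sign_scale -!Cinf_scalerAl !scalerA; congr (_ *: _).
  rewrite -{2}(finset.setD1K jI) !inversionsUl // inversionsUr // -!exprD.
  by apply: signr_eq; rewrite !oddD; do 4?case: (odd _).
(* Both factors contain [theta_j]: the product is zero, and the two terms on the right must
   cancel. *)
have -> : [disjoint I & J] = false by apply/pred0Pn; exists j; rewrite /= jI jJ.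
rewrite (op0 lin) -!smulE !smul_mono.
rewrite ![[disjoint _ & J]]disjoint_sym ![[disjoint J & _]]dD ?inE ?eqxx //.
rewrite [[disjoint I & _]]dD ?inE ?eqxx // disjoint_sym.
case: ifPn => dIJ; last by rewrite scaler0 addr0.
have -> : (I :|: J :\ j = I :\ j :|: J)%SET.
  by rewrite -{1}(finset.setD1K jI) -{2}(finset.setD1K jJ) finset.setUCA finset.setUA.
rewrite -monoZ -monoD !sign_scale -Cinf_scalerAl -Cinf_scalerAr !scalerA -scalerDl.
rewrite -[LHS](mono0 _ _ (I :\ j :|: J)); congr mono.
rewrite -[LHS](scale0r (a * b)); congr (_ *: _).
rewrite -{1}(finset.setD1K jJ) -{3 4}(finset.setD1K jI).
rewrite inversionsUr // inversionsUl // cardsU1 !inE eqxx /=.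
have := inversionsC (djS I); rewrite cards1 mul1n => <-.
(* Cancellation means that the exponents differ in parity; the minus sign is absorbed as one more
   factor. *)
apply/esym/eqP; rewrite addr_eq0 -[X in _ == X]mulN1r -!exprD -exprS; apply/eqP.
by apply: signr_eq; rewrite !(oddD, oddS) /=; do 4?case: (odd _).
Qed.

Lemma pd_oddM j p f g : homog p f ->
  pd_odd j (f * g) = pd_odd j f * g + (-1) ^+ p *: (f * pd_odd j g).
Proof.
have lin := @pd_odd_linear R m n j.
move=> hf; move: f hf; apply: homog_ind.
- by rewrite (op0 lin) !mul0r (op0 lin) scaler0 addr0.
- by move=> f f' fP f'P; rewrite mulrDl !(opD lin) !mulrDl fP f'P scalerDr addrACA.
move=> I a <-; elim/superfun_ind: g => [|g g' gP g'P|J b].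
- by rewrite (op0 lin) !mulr0 (op0 lin) scaler0 addr0.
- by rewrite mulrDr !(opD lin) !mulrDr gP g'P scalerDr addrACA.
by rewrite pd_odd_mono_mul signr_odd.
Qed.

Lemma pd_linear (i : 'I_(m + n)) : linear (@pd R m n i).
Proof.
by rewrite /pd; case: (fintype.split i) => a; [exact: pd_even_linear|exact: pd_odd_linear].
Qed.

Lemma superderivation_pd (i : 'I_(m + n)) :
  superderivation (coord_par i) (@pd R m n i).
Proof.
split; first exact: pd_linear.
- move=> q f hf; rewrite /pd /coord_par; case: fintype.splitP => [a ia|j ij] K.
    by rewrite leqNgt ia ltn_ord /= ffunE => /hf ->; rewrite dCinf0.
  rewrite ij leq_addr /= ffunE => oK; case: ifPn => // jK.
  by rewrite hf ?mulr0 // cardsU1 jK /=; case: (odd _) q oK {hf} => -[].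
move=> q f g hf; rewrite /pd /coord_par; case: fintype.splitP => [a ia|j ij].
  by rewrite leqNgt ia ltn_ord /= scale1r; exact: pd_evenM.
by rewrite ij leq_addr /=; exact: pd_oddM.
Qed.

Lemma superderivation0 p : superderivation p (0 : operator).
Proof.
split=> [c f g|q f _|q f g _]; last 1 first.
- rewrite !smulE [RHS](_ : _ = 0 * g + (-1) ^+ (p && q) *: (f * 0)) //.
  by rewrite mul0r mulr0 scaler0 addr0.
- by rewrite [RHS](_ : _ = c *: 0 + 0) // scaler0 addr0.
- exact: homog0.
Qed.

Lemma superderivationD p X Y :
  superderivation p X -> superderivation p Y -> superderivation p (X + Y).
Proof.
move=> [lX pX dX] [lY pY dY]; split=> [c f g|q f hf|q f g hf].
- by rewrite !add_opE lX lY addrACA -scalerDr.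
- by apply: homogD; [exact: pX|exact: pY].
rewrite !add_opE (dX _ _ _ hf) (dY _ _ _ hf) !smulE addrACA -mulrDl.
by rewrite -scalerDr -mulrDr.
Qed.

Lemma superderivation_sum p (T : Type) (r : seq T) (P : pred T) (F : T -> operator) :
  (forall i, P i -> superderivation p (F i)) ->
  superderivation p (\sum_(i <- r | P i) F i).
Proof.
by move=> dF; apply: big_ind => //; [exact: superderivation0|exact: superderivationD].
Qed.

(** Moving [f] past a factor of parity [r] costs [(-1) ^+ (p && r)], which turns the Leibniz sign of
    parity [q] into that of [p (+) q]. *)
Lemma superderivation_fmul p q f X :
  homog p f -> superderivation q X -> superderivation (p (+) q) (fmul f X).
Proof.
move=> hf [lX pX dX]; rewrite /fmul; split=> [c g h|r g hg|r g h hg].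
- by rewrite lX smulDr superfun_scaleAr.
- by rewrite -addbA; apply: homogM => //; exact: pX.
rewrite (dX _ _ _ hg) !smulE mulrDr -superfun_scaleAr !mulrA; congr (_ + _).
rewrite (supercommute hf hg) -superfun_scaleAl scalerA; congr (_ *: _).
by case: p q r {hf pX dX hg} => -[] [] /=; rewrite ?mul1r ?mulr1 // -expr2 sqrr_sign.
Qed.

(** The Leibniz expansion of the supercommutator on a product [f * g]: [a], [a'] stand for
    [X (Y f) * g] and [Y (X f) * g], [b], [b'] for [f * X (Y g)] and [f * Y (X g)]. The mixed terms
    [u], for [Y f * X g], and [v], for [X f * Y g], cancel. *)
Lemma supercommutator_leibniz (a b a' b' u v : superfun) (p q r : bool) :
  a + (-1) ^+ (p && (q (+) r)) *: u +
    (-1) ^+ (q && r) *: (v + (-1) ^+ (p && r) *: b) -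
  (-1) ^+ (p && q) *: (a' + (-1) ^+ (q && (p (+) r)) *: v +
    (-1) ^+ (p && r) *: (u + (-1) ^+ (q && r) *: b')) =
  a - (-1) ^+ (p && q) *: a' +
    (-1) ^+ ((p (+) q) && r) *: (b - (-1) ^+ (p && q) *: b').
Proof.
(* Comparing coefficients moves the identity into the commutative ring [Cinf R m], where [ring]
   applies once the signs are ring elements. *)
apply/ffunP => K; rewrite !ffunE -!sign_scale.
by case: p q r => -[] [] /=; ring.
Qed.

Lemma superderivation_commutator p q X Y :
  superderivation p X -> superderivation q Y ->
  superderivation (p (+) q) (X \o Y - (-1) ^+ (p && q) *: (Y \o X) : operator).
Proof.
move=> [lX pX dX] [lY pY dY].
have E f : (X \o Y - (-1) ^+ (p && q) *: (Y \o X) : operator) f =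
  X (Y f) - (-1) ^+ (p && q) *: Y (X f) by [].
split=> [c f g|r f hf|r f g hf]; rewrite ?E.
- rewrite !(lX, lY) scalerDr opprD addrACA scalerBr !scalerA.
  by rewrite [c * _]mulrC.
- apply: homogD; first by rewrite -addbA; apply: pX; exact: pY.
  by apply/homogN/homogZ; rewrite addbAC addbC; apply: pY; exact: pX.
rewrite (dX _ _ _ hf) (dY _ _ _ hf) !(opD lX) !(opD lY) !(opZ lX) !(opZ lY).
rewrite (dX _ _ _ (pY _ _ hf)) (dX _ _ _ hf) (dY _ _ _ (pX _ _ hf)) (dY _ _ _ hf).
rewrite supercommutator_leibniz !smulE.
by rewrite mulrDl mulrDr mulNr mulrN superfun_scaleAl superfun_scaleAr.
Qed.

(** [X] sends parity [r] to [p (+) r], so the projection to [q (+) r] keeps everything when [q] is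
    [p] and nothing otherwise. *)
Lemma opart_superderivation p q X :
  superderivation p X -> opart q X = if q == p then X else 0.
Proof.
move=> [lX pX dX]; apply/funext => f; rewrite /opart.
transitivity (\sum_(r : bool) if q == p then X (hpart r f) else 0).
  apply: eq_bigr => r _; rewrite (hpartE _ (pX _ _ (@homog_hpart _ _ _ r f))).
  by case: p q r {pX dX} => -[] [].
case: eqP => _; last by rewrite big1.
by rewrite -op_sum // -hpart_sum.
Qed.

Lemma opartD p X Y : opart p (X + Y) = opart p X + opart p Y.
Proof.
apply/funext => f; rewrite add_opE /opart -big_split /=.
by apply: eq_bigr => q _; rewrite -raddfD.
Qed.

Lemma Vect_superderivation p X : superderivation p X -> Vect X.
Proof.
move=> dX; split=> [|q]; first by case: dX.
rewrite (opart_superderivation _ dX); case: eqP => [->//|_].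
exact: superderivation0.
Qed.

Lemma VectD X Y : Vect X -> Vect Y -> Vect (X + Y).
Proof.
move=> [lX dX] [lY dY]; split=> [c f g|p].
  by rewrite !add_opE lX lY addrACA -scalerDr.
by rewrite opartD; apply: superderivationD.
Qed.

Lemma Vect_sum (T : Type) (r : seq T) (P : pred T) (F : T -> operator) :
  (forall i, P i -> Vect (F i)) -> Vect (\sum_(i <- r | P i) F i).
Proof.
move=> dF; apply: big_ind => //; last exact: VectD.
exact: (@Vect_superderivation false _ (superderivation0 _)).
Qed.

Lemma Vect_bracket X Y : Vect X -> Vect Y -> Vect (bracket X Y).
Proof.
move=> [_ dX] [_ dY]; apply: Vect_sum => p _; apply: Vect_sum => q _.
exact: Vect_superderivation (superderivation_commutator (dX p) (dY q)).
Qed.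

(** The Leibniz rule on [1 * 1] reads [X 1 = X 1 + X 1]. *)
Lemma superderivation1 p X : superderivation p X -> X 1 = 0.
Proof.
move=> [lX _ /(_ false 1 1 (@homog1 _ _ _))].
rewrite andbF scale1r !smulE !mulr1 mul1r => E.
by apply: (addrI (X 1)); rewrite addr0.
Qed.

Lemma opart_sum X : linear X -> \sum_p opart p X = X.
Proof.
move=> lX; apply/funext => f; rewrite sum_opE [in RHS](hpart_sum f) (op_sum lX).
rewrite exchange_big; apply: eq_bigr => r _ /=.
(* For a fixed input parity [r], adding [r] permutes the output parities. *)
rewrite [RHS]hpart_sum [RHS](reindex_inj (@addIb r)) /=.
by apply: eq_bigr => p _.
Qed.

Lemma Vect1 X : Vect X -> X 1 = 0.
Proof.
move=> [lX dX]; rewrite -(opart_sum lX) sum_opE big1 // => p _.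
exact: superderivation1 (dX p).
Qed.

End Superderivations.

(** * Projective fields in homogeneous coordinates and the invariance computation *)

Section ProjectiveFields.
Local Open Scope ring_scope.
Variables (R : realType) (m n : nat).
Local Notation superfun := (superfun R m n).
Local Notation operator := (operator R m n).
Local Notation gl := 'M[R]_(1 + (m + n)).
Implicit Types (A : gl) (f g : superfun) (X T : operator).

Lemma homog_coord (i : 'I_(m + n)) : homog (coord_par i) (Defs.coord R i).
Proof.
rewrite /Defs.coord /coord_par; case: fintype.splitP => [a ia|j ij].
  rewrite leqNgt ia ltn_ord; have := @homog_mono R m n finset.set0 (coordCinf R a).
  by rewrite cards0.
rewrite ij leq_addr; have := @homog_mono R m n [set j] 1.
by rewrite cards1.
Qed.

(* The homogeneous coordinates: index 0 stands for t^0 = 1. *)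
Definition hcoord (k : 'I_(1 + (m + n))) : superfun :=
  match fintype.split k with inl _ => 1 | inr i => Defs.coord R i end.

Definition hpar (k : 'I_(1 + (m + n))) : bool := (1 + m <= k)%N.

Lemma hcoord0 : hcoord 0 = 1.
Proof. by rewrite /hcoord; case: fintype.splitP. Qed.

Lemma hcoord_rshift (i : 'I_(m + n)) : hcoord (rshift 1 i) = Defs.coord R i.
Proof.
rewrite /hcoord; case: fintype.splitP => [[[]]//|j /eqP].
by rewrite eqn_add2l => /eqP /val_inj ->.
Qed.

Lemma homog_hcoord k : homog (hpar k) (hcoord k).
Proof.
rewrite /hcoord /hpar; case: fintype.splitP => [j kj|i ki].
  by rewrite kj ord1; exact: homog1.
by rewrite ki leq_add2l; exact: homog_coord.
Qed.

(** The [F_k] of [A]. For [k = 0] the sign is the one that [Phi] puts before [xi], and for the other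
    [k] the one before [B]. *)
Definition hlin A (k : 'I_(1 + (m + n))) : superfun :=
  \sum_j ((-1) ^+ (hpar j && (hpar k (+) hpar j)) * A k j) *: hcoord j.

Lemma sum_hindex (F : 'I_(1 + (m + n)) -> superfun) :
  \sum_k F k = F 0 + \sum_(i < m + n) F (rshift 1 i).
Proof. by rewrite big_split_ord big_ord1; congr (F _ + _); apply: val_inj. Qed.

Definition projective_field A : operator :=
  \sum_(i < m + n) fmul (hlin A 0 * Defs.coord R i - hlin A (rshift 1 i)) (@pd R m n i).

(** [Phi] uses the representative with zero top left entry, [projective_field] uses [A] itself.
    Subtracting [a%:M] from [A] lowers both [F_0 t^i] and [F_i] by [a t^i], so their difference does
    not change. *)
Lemma Phi_pgl_class A : Phi (pgl_class A) = projective_field A.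
Proof.
rewrite /Phi pgl_repE; set a := A 0 0; apply/funext => f.
rewrite /projective_field sum_opE !add_opE.
have opNE (X : operator) : (- X) f = - X f by [].
rewrite !opNE !sum_opE -!sumrN -!big_split /=; apply: eq_bigr => i _.
have h0 : hpar 0 = false by [].
have hr (j : 'I_(m + n)) : hpar (rshift 1 j) = coord_par j.
  by rewrite /hpar /coord_par leq_add2l.
rewrite scale_opE !sum_opE /hlin !sum_hindex.
rewrite hcoord0 h0 /fmul smulE.
under [X in _ = (_ - (_ + X)) * _]eq_bigr => j _ do rewrite hcoord_rshift !hr.
under [X in _ = ((_ + X) * _ - _) * _]eq_bigr => j _ do rewrite hcoord_rshift !hr andbb.
set p := pd i f; set t := Defs.coord R i; rewrite !mul1r.
have -> : dlsubmx (A - a%:M) i 0 = A (rshift 1 i) 0.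
  by rewrite !mxE subr0; congr (A _ _); apply: val_inj.
(* Normalising lowers the diagonal of [B] by [a], whence the extra term; it matches the constant
   term [a] of [F_0]. *)
have -> : \sum_j (((-1) ^+ (coord_par j && (coord_par i (+) coord_par j)) *
       drsubmx (A - a%:M) i j) *: (fun g => smul (Defs.coord R j) (pd i g))) f =
    (\sum_j ((-1) ^+ (coord_par j && (coord_par i (+) coord_par j)) *
       A (rshift 1 i) (rshift 1 j)) *: Defs.coord R j) * p - a *: (t * p).
  rewrite mulr_suml [LHS](bigD1 i) //= [in RHS](bigD1 i) //= [RHS]addrAC.
  congr (_ + _).
    rewrite scale_opE !mxE eqxx mulr1n addbb andbF !mul1r scalerBl.
    by rewrite -superfun_scaleAl.
  apply: eq_bigr => j ji; rewrite scale_opE !mxE (inj_eq (@rshift_inj _ _)).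
  by rewrite eq_sym (negbTE ji) subr0 -superfun_scaleAl.
have -> : \sum_j (((-1) ^+ coord_par j * ursubmx (A - a%:M) 0 j) *:
      (fun g => smul (smul (Defs.coord R j) t) (pd i g))) f =
    (\sum_j ((-1) ^+ coord_par j * A 0 (rshift 1 j)) *: Defs.coord R j) * t * p.
  rewrite !mulr_suml; apply: eq_bigr => j _; rewrite scale_opE !mxE subr0.
  rewrite -!superfun_scaleAl; congr ((_ * A _ _) *: _).
  exact: val_inj.
rewrite mulrBl !mulrDl -!superfun_scaleAl !mul1r.
rewrite -/a opprB !opprD !addrA.
by rewrite -!addrA addrCA; congr (_ + _); rewrite [RHS]addrC -addrA.
Qed.

Lemma hlinD A B k : hlin (A + B) k = hlin A k + hlin B k.
Proof.
by rewrite -big_split; apply: eq_bigr => j _; rewrite mxE mulrDr scalerDl.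
Qed.

Lemma projective_fieldD A B :
  projective_field (A + B) = projective_field A + projective_field B.
Proof.
apply/funext => f; rewrite /projective_field add_opE !sum_opE -big_split /=.
apply: eq_bigr => i _.
by rewrite /fmul !smulE -mulrDl; congr (_ * _); rewrite !hlinD mulrDl opprD addrACA.
Qed.

(** At [k = 0] both sides vanish, since [t^0 = 1] is killed by derivations; the other indices are
    [coefE]. *)
Lemma projective_field_hcoord A k :
  projective_field A (hcoord k) = hlin A 0 * hcoord k - hlin A k.
Proof.
have [[j ->]|[i ->]] : (exists j : 'I_1, k = lshift _ j) \/ (exists i, k = rshift 1 i).
- by case: (fintype.splitP k) => j kj; [left|right]; exists j; exact: val_inj.
- have -> : lshift (m + n) j = 0 by apply: val_inj; rewrite ord1.
  rewrite hcoord0 mulr1 subrr /projective_field sum_opE big1 // => i _.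
  by rewrite /fmul (superderivation1 (@superderivation_pd R m n i)) smulE mulr0.
rewrite hcoord_rshift.
apply: (@Defs.coefE R m n _
  (fun i => hlin A 0 * Defs.coord R i - hlin A (rshift 1 i))) => f.
by rewrite /projective_field sum_opE.
Qed.

Definition homog_mx (p : bool) A :=
  forall h k, hpar h (+) hpar k != p -> A h k = 0.

Lemma homog_mxM p q A B : homog_mx p A -> homog_mx q B -> homog_mx (p (+) q) (A *m B).
Proof.
move=> hA hB i j ij; rewrite mxE big1 // => k _.
have [ik|/hA ->] := eqVneq (hpar i (+) hpar k) p; last by rewrite mul0r.
rewrite hB ?mulr0 //; apply: contra_neq ij => <-; rewrite -ik.
by case: (hpar i) (hpar k) (hpar j) => -[] [].
Qed.

Lemma homog_mx_tr p A : homog_mx p A -> homog_mx p A^T.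
Proof. by move=> hA i j ij; rewrite mxE hA // addbC. Qed.

Section Homogeneous.
Variables (p : bool) (A : gl) (hA : homog_mx p A).

(** The nonzero entries satisfy [hpar k (+) hpar j = p], so the sign depends on [k] only through
    [p]. *)
Lemma hlinE k : hlin A k = \sum_j ((-1) ^+ (p && hpar j) * A k j) *: hcoord j.
Proof.
apply: eq_bigr => j _; have [<-|/hA ->] := eqVneq (hpar k (+) hpar j) p.
  by rewrite andbC.
by rewrite !mulr0.
Qed.

Lemma homog_hlin k : homog (p (+) hpar k) (hlin A k).
Proof.
apply: homog_sum => j _; have [E|/hA ->] := eqVneq (hpar k (+) hpar j) p.
  by apply: homogZ; rewrite -E addbAC addbb; exact: homog_hcoord.
by rewrite mulr0 scale0r; exact: homog0.
Qed.

Lemma superderivation_projective_field : superderivation p (projective_field A).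
Proof.
apply: superderivation_sum => i _.
(* The coefficient along [t^i] has parity [p (+) coord_par i], and the partial derivative has parity
   [coord_par i]. *)
have -> : p = (p (+) coord_par i) (+) coord_par i by rewrite -addbA addbb addbF.
apply: superderivation_fmul; last exact: superderivation_pd.
apply: homogD.
  by apply: homogM; [have := @homog_hlin 0; rewrite /hpar addbF|exact: homog_coord].
apply: homogN; have := @homog_hlin (rshift 1 i).
by rewrite /hpar /coord_par leq_add2l.
Qed.

End Homogeneous.

Section Invariance.
Variables (G : gl) (hG : homog_mx false G).

(* For G = spo_G these are the coefficients of the contact form, see alphaE. *)
Definition hdual k : superfun := \sum_j G k j *: hcoord j.

Lemma homog_hdual k : homog (hpar k) (hdual k).
Proof.
apply: homog_sum => j _; have [kj|kj] := eqVneq (hpar k) (hpar j).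
  by rewrite kj; apply: homogZ; exact: homog_hcoord.
by rewrite hG ?scale0r; [exact: homog0|case: (hpar k) (hpar j) kj => -[]].
Qed.

Variables (p : bool) (A : gl) (hA : homog_mx p A).

Lemma projective_field_hdual k : projective_field A (hdual k) =
  hlin A 0 * hdual k - \sum_j G k j *: hlin A j.
Proof.
have [lX _ _] := superderivation_projective_field hA.
rewrite (op_sum lX) mulr_sumr -sumrB; apply: eq_bigr => j _.
by rewrite (opZ lX) projective_field_hcoord scalerBr -superfun_scaleAr.
Qed.

(** The defining condition of [spo] on matrix entries, supplied by [spo_mxpart] when [G] is
    [spo_G]. *)
Hypothesis invG :
  forall k j, (-1) ^+ (p && hpar j) * (G *m A) k j + (A^T *m G) k j = 0.

(** The coefficient of each [hcoord i] on the left is an instance of [invG]. *)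
Lemma hlin_hdual k : \sum_j G k j *: hlin A j + \sum_j A j k *: hdual j = 0.
Proof.
have -> : \sum_j G k j *: hlin A j =
    \sum_i ((-1) ^+ (p && hpar i) * (G *m A) k i) *: hcoord i.
  under eq_bigr => j _ do rewrite (hlinE hA) scaler_sumr.
  rewrite exchange_big /=; apply: eq_bigr => i _.
  rewrite mxE mulr_sumr scaler_suml; apply: eq_bigr => j _.
  by rewrite scalerA mulrCA.
have -> : \sum_j A j k *: hdual j = \sum_i (A^T *m G) k i *: hcoord i.
  under eq_bigr => j _ do rewrite scaler_sumr.
  rewrite exchange_big /=; apply: eq_bigr => i _.
  rewrite mxE scaler_suml; apply: eq_bigr => j _.
  by rewrite scalerA mxE.
rewrite -big_split /= big1 // => i _.
by rewrite -scalerDl invG scale0r.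
Qed.

Hypothesis hcoord_hdual : \sum_k hcoord k * hdual k = 0.

Lemma commutator_hdual (q : bool) T : superderivation q T ->
  \sum_k T (hcoord k) * hdual k = 0 ->
  \sum_k (projective_field A \o T - (-1) ^+ (p && q) *: (T \o projective_field A)
     : operator) (hcoord k) * hdual k = 0.
Proof.
move=> [lT pT dT] T0; set X := projective_field A.
have [lX _ dX] : superderivation p X := superderivation_projective_field hA.
have XM r f g : homog r f ->
    X (f * g) = X f * g + (-1) ^+ (p && r) *: (f * X g) := dX r f g.
have TM r f g : homog r f ->
    T (f * g) = T f * g + (-1) ^+ (q && r) *: (f * T g) := dT r f g.
have hT k : homog (q (+) hpar k) (T (hcoord k)) by exact/pT/homog_hcoord.
set F0 := hlin A 0; have hF0 : homog p F0.
  by have := @homog_hlin p A hA 0; rewrite /hpar addbF.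
have XT0 : \sum_k X (T (hcoord k)) * hdual k =
    \sum_k (-1) ^+ (p && (q (+) hpar k)) *:
      (T (hcoord k) * \sum_j G k j *: hlin A j).
  apply/eqP; rewrite -subr_eq0; apply/eqP.
  (* Apply [X] to the vanishing sum and subtract [F0] times that sum: after [F0] is moved past
     [T (hcoord k)], this cancels the [F0] part of [X (hdual k)]. *)
  transitivity (X (\sum_k T (hcoord k) * hdual k) -
      F0 * (\sum_k T (hcoord k) * hdual k)); last first.
    by rewrite T0 (op0 lX) mulr0 subr0.
  rewrite (op_sum lX) mulr_sumr -!sumrB; apply: eq_bigr => k _.
  rewrite (XM _ _ _ (hT k)) [X (hdual k)]projective_field_hdual.
  rewrite mulrBr scalerBr !mulrA (supercommute hF0 (hT k)) -superfun_scaleAl.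
  by rewrite -[RHS]addrA [in RHS]addrAC subrr add0r.
have TX0 : \sum_k T (X (hcoord k)) * hdual k =
    - \sum_k (-1) ^+ (p && hpar k) *:
      (T (hcoord k) * \sum_j A j k *: hdual j).
  transitivity (- \sum_k T (hlin A k) * hdual k).
    (* Expanding [T (F0 * hcoord k)] gives two sums, which vanish by [hcoord_hdual] and by the
       tangency of [T]; only [T (hlin A k)] is left. *)
    transitivity (T F0 * (\sum_k hcoord k * hdual k) +
        (-1) ^+ (q && p) *: (F0 * (\sum_k T (hcoord k) * hdual k)) -
        \sum_k T (hlin A k) * hdual k); last first.
      by rewrite T0 hcoord_hdual !mulr0 scaler0 addr0 add0r.
    rewrite !mulr_sumr scaler_sumr -big_split -sumrB /=; apply: eq_bigr => k _.
    rewrite [X _]projective_field_hcoord (opD lT) (opN lT) mulrDl mulNr.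
    rewrite (TM _ _ _ hF0) mulrDl -!mulrA.
    by rewrite -superfun_scaleAl -!mulrA.
  (* Exchanging the two summations makes the coefficients of [A] act on [hdual] through the
     transpose. *)
  congr (- _); under eq_bigr => k _ do rewrite (hlinE hA) (op_sum lT) mulr_suml.
  rewrite exchange_big /=; apply: eq_bigr => k _.
  rewrite mulr_sumr scaler_sumr; apply: eq_bigr => j _.
  by rewrite (opZ lT) -superfun_scaleAl -superfun_scaleAr scalerA.
transitivity (\sum_k X (T (hcoord k)) * hdual k -
    (-1) ^+ (p && q) *: \sum_k T (X (hcoord k)) * hdual k).
  rewrite scaler_sumr -sumrB; apply: eq_bigr => k _.
  by rewrite superfun_scaleAl -mulrBl.
rewrite XT0 TX0 scalerN opprK scaler_sumr -big_split /= big1 // => k _.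
rewrite scalerA -exprD.
(* The signs of the two sums agree, so [hlin_hdual] applies term by term. *)
have -> : (-1) ^+ ((p && q) + (p && hpar k)) = (-1) ^+ (p && (q (+) hpar k)) :> R.
  by apply: signr_eq; rewrite oddD !oddb; case: (p) (q) (hpar k) => -[] [].
by rewrite -scalerDr -mulrDr hlin_hdual mulr0 scaler0.
Qed.

End Invariance.

End ProjectiveFields.

(** * The contact form through [spo_G], the entries of [spo] matrices, and tangency of brackets *)

Section ContactFields.
Local Open Scope ring_scope.
Variables (R : realType) (l n : nat).
Local Notation dim0 := (l + (1 + l))%N.
Local Notation superfun := (superfun R dim0 n).
Local Notation operator := (operator R dim0 n).
Local Notation gl := 'M[R]_(1 + (dim0 + n)).
Local Notation index := 'I_(1 + (dim0 + n)).
Implicit Types (A : gl) (f g : superfun) (X T : operator).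

(* upper runs over t^0, x_1, ..., x_l and lower over z, y_1, ..., y_l. *)
Definition upper (a : 'I_(1 + l)) : index :=
  lshift n (lshift (1 + l) a) : 'I_((1 + l) + (1 + l) + n).
Definition lower (a : 'I_(1 + l)) : index :=
  lshift n (rshift (1 + l) a) : 'I_((1 + l) + (1 + l) + n).
Definition oddix (j : 'I_n) : index :=
  rshift ((1 + l) + (1 + l)) j : 'I_((1 + l) + (1 + l) + n).

Lemma sum_index (V : nmodType) (F : index -> V) :
  \sum_k F k = \sum_a F (upper a) + \sum_a F (lower a) + \sum_j F (oddix j).
Proof. by rewrite (@big_split_ord _ _ _ ((1 + l) + (1 + l)) n) big_split_ord. Qed.

Local Notation G := (spo_G R l n).
Local Notation hdual := (hdual G).
Local Notation hcoord := (@hcoord R dim0 n).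

Lemma index_ind (P : index -> Prop) : (forall a, P (upper a)) ->
  (forall a, P (lower a)) -> (forall j, P (oddix j)) -> forall k, P k.
Proof.
move=> Pu Pl Po k; rewrite -[k](@splitK ((1 + l) + (1 + l)) n).
case: fintype.split => [b|j] /=; last exact: Po.
by rewrite -[b]splitK; case: fintype.split.
Qed.

(** Stated as a tuple so that one rewrite rule covers every block. *)
Lemma spo_GE : (forall a b, G (upper a) (upper b) = 0) *
  (forall a b, G (upper a) (lower b) = - (a == b)%:R) *
  (forall a j, G (upper a) (oddix j) = 0) *
  (forall a b, G (lower a) (upper b) = (a == b)%:R) *
  (forall a b, G (lower a) (lower b) = 0) *
  (forall a j, G (lower a) (oddix j) = 0) *
  (forall j a, G (oddix j) (upper a) = 0) *
  (forall j a, G (oddix j) (lower a) = 0) *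
  (forall i j, G (oddix i) (oddix j) = (i == j)%:R).
Proof.
have ul u v : G (lshift n u : 'I_((1 + l) + (1 + l) + n))
    (lshift n v : 'I_((1 + l) + (1 + l) + n)) = spo_J R l u v by exact: block_mxEul.
have ur u v : G (lshift n u : 'I_((1 + l) + (1 + l) + n))
    (rshift (1 + l + (1 + l)) v : 'I_((1 + l) + (1 + l) + n)) = 0.
  by rewrite [LHS]block_mxEur mxE.
have dl u v : G (rshift (1 + l + (1 + l)) u : 'I_((1 + l) + (1 + l) + n))
    (lshift n v : 'I_((1 + l) + (1 + l) + n)) = 0.
  by rewrite [LHS]block_mxEdl mxE.
have dr u v : G (rshift (1 + l + (1 + l)) u : 'I_((1 + l) + (1 + l) + n))
    (rshift (1 + l + (1 + l)) v : 'I_((1 + l) + (1 + l) + n)) = (u == v)%:R.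
  by rewrite [LHS]block_mxEdr mxE.
do ![apply: pair]; move=> a b; rewrite ?(ur, dl, dr) // ul /spo_J.
- by rewrite block_mxEul mxE.
- by rewrite block_mxEur !mxE.
- by rewrite block_mxEdl mxE.
by rewrite block_mxEdr mxE.
Qed.

Lemma hparE : (forall a, hpar (upper a) = false) *
  (forall a, hpar (lower a) = false) * (forall j, hpar (oddix j) = true).
Proof.
do ![apply: pair]; move=> a; rewrite /hpar /=.
- by rewrite leqNgt (leq_trans (ltn_ord a)) // leq_addr.
- by rewrite leqNgt addnA ltn_add2l ltn_ord.
by rewrite addnA leq_addr.
Qed.

Lemma spo_G_homog : homog_mx false G.
Proof.
by elim/index_ind => a; elim/index_ind => b; rewrite !hparE ?spo_GE.
Qed.

(** With [t^0] restored the contact form becomes homogeneous: the pair [t^0, z] enters like each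
    pair [x_i, y_i], which is the shape of [spo_J]. *)
Lemma hdualE : (forall a, hdual (upper a) = - hcoord (lower a)) *
  (forall a, hdual (lower a) = hcoord (upper a)) *
  (forall j, hdual (oddix j) = hcoord (oddix j)).
Proof.
have sum0 (T : finType) (c : T -> R) (v : T -> superfun) :
    (forall i, c i = 0) -> \sum_i c i *: v i = 0.
  by move=> c0; rewrite big1 // => i _; rewrite c0 scale0r.
have sum1 (T : finType) (i : T) (c : T -> R) (v : T -> superfun) (e : R) :
    (forall j, c j = e * (i == j)%:R) -> \sum_j c j *: v j = e *: v i.
  move=> c1; rewrite (bigD1 i) //= big1 => [|j ji]; rewrite c1.
    by rewrite eqxx mulr1 addr0.
  by rewrite eq_sym (negbTE ji) mulr0 scale0r.
rewrite /hdual; do ![apply: pair]; move=> a; rewrite sum_index.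
- rewrite sum0 ?add0r => [|b]; last by rewrite spo_GE.
  rewrite (sum1 _ a _ _ (-1)) ?scaleN1r => [|b]; last by rewrite spo_GE mulN1r.
  by rewrite sum0 ?addr0 // => b; rewrite spo_GE.
- rewrite (sum1 _ a _ _ 1) ?scale1r => [|b]; last by rewrite spo_GE mul1r.
  by rewrite !sum0 ?addr0 // => b; rewrite spo_GE.
rewrite sum0 ?add0r => [|b]; last by rewrite spo_GE.
rewrite sum0 ?add0r => [|b]; last by rewrite spo_GE.
by rewrite (sum1 _ a _ _ 1) ?scale1r => [//|b]; rewrite spo_GE mul1r.
Qed.

Lemma sum_hdual (F : index -> superfun) : \sum_k F k * hdual k =
  \sum_a (F (lower a) * hcoord (upper a) - F (upper a) * hcoord (lower a))
  + \sum_j F (oddix j) * hcoord (oddix j).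
Proof.
rewrite sum_index; congr (_ + _); last by apply: eq_bigr => j _; rewrite hdualE.
by rewrite addrC -big_split; apply: eq_bigr => a _; rewrite !hdualE mulrN.
Qed.

(** Even coordinates are central; an arbitrary [f] is split into its homogeneous parts. *)
Lemma mulC_even k f : hpar k = false -> hcoord k * f = f * hcoord k.
Proof.
move=> k0; rewrite [f]hpart_sum mulr_sumr mulr_suml; apply: eq_bigr => p _.
have := @homog_hcoord R dim0 n k; rewrite k0 => hk.
by rewrite (supercommute hk (@homog_hpart _ _ _ p f)) scale1r.
Qed.

(** The terms of paired even coordinates cancel because these commute, and each odd coordinate
    squares to zero. *)
Lemma hcoord_hdual : \sum_k hcoord k * hdual k = 0.
Proof.
rewrite sum_hdual big1 => [|a _]; last by rewrite mulC_even ?hparE // subrr.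
rewrite add0r big1 // => j _; apply: homog_odd_sqr.
by rewrite -(hparE.2 j); exact: homog_hcoord.
Qed.

Lemma hcoordE : (hcoord (upper (lshift l ord0)) = 1) *
  (forall i, hcoord (upper (rshift 1 i)) = tx R n i) *
  (hcoord (lower (lshift l ord0)) = tz R l n) *
  (forall i, hcoord (lower (rshift 1 i)) = ty R n i) *
  (forall j, hcoord (oddix j) = ttheta R l j).
Proof.
do ![apply: pair] => [|i||i|j]; rewrite ?/tx ?/tz ?/ty ?/ttheta -?hcoord_rshift;
  first by rewrite -(hcoord0 R dim0 n); congr (hcoord _); apply: val_inj.
all: by congr (hcoord _); apply: val_inj.
Qed.

(** [X 1 = 0] removes the term of [t^0], and [t^0 = 1] reduces the term of [z] to [X z]. Even
    coordinates may be moved to the left, where [alpha] has them. *)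
Lemma alphaE X : X 1 = 0 -> alpha X = \sum_k X (hcoord k) * hdual k.
Proof.
move=> X1; rewrite sum_hdual big_split_ord big_ord1 /= !hcoordE X1 mul0r subr0 mulr1.
rewrite /alpha; congr (_ + _ + _); last by apply: eq_bigr => j _; rewrite hcoordE.
apply: eq_bigr => i _; rewrite !hcoordE.
have ux : hpar (upper (rshift 1 i)) = false by rewrite hparE.
have uy : hpar (lower (rshift 1 i)) = false by rewrite hparE.
by rewrite -!hcoordE !smulE !mulC_even.
Qed.

Lemma opart_hcoord q X k : linear X ->
  opart q X (hcoord k) = hpart (q (+) hpar k) (X (hcoord k)).
Proof.
move=> lX; rewrite /opart (bigD1 (hpar k)) //= big1 ?addr0 => [|p pk].
  by rewrite (hpartE _ (@homog_hcoord _ _ _ k)) eqxx.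
by rewrite (hpartE _ (@homog_hcoord _ _ _ k)) (negbTE pk) (op0 lX) raddf0.
Qed.

(** Since [hdual k] has the parity of [hcoord k], the contact form is even. Hence the homogeneous
    parts of a tangent field are tangent. *)
Lemma alpha_opart q X : Vect X -> alpha (opart q X) = hpart q (alpha X).
Proof.
move=> VX; have [lX dX] := VX.
rewrite alphaE ?(superderivation1 (dX q)) // (alphaE (Vect1 VX)) raddf_sum /=.
apply: eq_bigr => k _; rewrite opart_hcoord // hpart_mulr //.
exact: homog_hdual spo_G_homog _.
Qed.

Lemma homog_mxpart p A : homog_mx p (mxpart p A).
(* [gl_par] and [hpar] are convertible. *)
Proof. by move=> i j /negbTE ij; rewrite mxE [X in if X then _ else _]ij. Qed.

Lemma mxpart_sum A : A = mxpart false A + mxpart true A.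
Proof.
by apply/matrixP => i j; rewrite !mxE; case: (_ (+) _); rewrite ?addr0 ?add0r.
Qed.

Lemma delta_form A k j :
  ((delta_mx k 0 : 'cV[R]_(1 + (dim0 + n)))^T *m A *m delta_mx j (0 : 'I_1)) 0 0 = A k j.
Proof. by rewrite trmx_delta -rowE -colE !mxE. Qed.

Lemma spo_omega_deltal A k j :
  spo_omega (A *m delta_mx j 0) (delta_mx k 0) = (G *m A) k j.
Proof. by rewrite /spo_omega mulmxA -[_ *m G *m A]mulmxA delta_form. Qed.

Lemma spo_omega_deltar A k j :
  spo_omega (delta_mx j 0) (A *m delta_mx k 0) = (A^T *m G) k j.
Proof. by rewrite /spo_omega trmx_mul -[_ *m A^T *m G]mulmxA delta_form. Qed.

Lemma vpart_delta (q : bool) j : vpart q (delta_mx j 0 : 'cV[R]_(1 + (dim0 + n))) =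
  if q == hpar j then delta_mx j 0 else 0.
Proof.
apply/matrixP => i o; rewrite !mxE ord1 [gl_par _]/(hpar i).
have [->|ij] := eqVneq i j; last first.
  by rewrite if_same; case: ifP => _; rewrite !mxE ?(negbTE ij).
by rewrite eq_sym; case: ifP => _; rewrite !mxE ?eqxx.
Qed.

(** Evaluating the form on the basis vectors of indices [j] and [k] extracts the entry [(k, j)]; its
    parity isolates one homogeneous part of [A]. *)
Lemma spo_mxpart A p k j : spo R l n A ->
  (-1) ^+ (p && hpar j) * (G *m mxpart p A) k j + ((mxpart p A)^T *m G) k j = 0.
Proof.
move=> spoA.
have hGA q := homog_mxM spo_G_homog (@homog_mxpart q A).
have hAG q := homog_mxM (homog_mx_tr (@homog_mxpart q A)) spo_G_homog.
have [kj|kj] := eqVneq (hpar k (+) hpar j) p; last first.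
  by rewrite hGA // hAG ?addbF // mulr0 addr0.
have := spoA (delta_mx j 0) (delta_mx k 0).
have oE q : \sum_(r : bool)
    (spo_omega (mxpart q A *m vpart r (delta_mx j 0)) (delta_mx k 0)
     + (-1) ^+ (q && r) * spo_omega (vpart r (delta_mx j 0)) (mxpart q A *m delta_mx k 0))
   = (G *m mxpart q A) k j + (-1) ^+ (q && hpar j) * ((mxpart q A)^T *m G) k j.
  rewrite (bigD1 (hpar j)) //= big1 ?addr0 => [|r rj]; rewrite vpart_delta.
    by rewrite eqxx spo_omega_deltal spo_omega_deltar.
  by rewrite (negbTE rj) mulmx0 /spo_omega !mulmx0 mxE mulr0 addr0.
rewrite (eq_bigr _ (fun q _ => oE q)) (bigD1 p) //= big1 ?addr0 => [|q qp]; last first.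
  by rewrite hGA ?hAG ?mulr0 ?addr0 // ?addbF kj eq_sym.
(* In [E] the sign stands before the transposed term; multiplying by it, its square being 1, moves
   it to the other one. *)
move=> E; rewrite -[RHS](mulr0 ((-1) ^+ (p && hpar j))) -E mulrDr mulrA -expr2.
by rewrite sqrr_sign mul1r.
Qed.

Lemma opart_projective_field A p :
  opart p (projective_field A) = projective_field (mxpart p A).
Proof.
rewrite {1}(mxpart_sum A) projective_fieldD opartD.
have d q := superderivation_projective_field (@homog_mxpart q A).
by rewrite !(opart_superderivation _ (d _)); case: p; rewrite /= ?addr0 ?add0r.
Qed.

Lemma Vect_projective_field A : Vect (projective_field A).
Proof.
rewrite (mxpart_sum A) projective_fieldD.
by apply: VectD; apply: Vect_superderivation;
  exact: superderivation_projective_field (@homog_mxpart _ A).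
Qed.

(** The bracket is a sum over parities of supercommutators of homogeneous parts, each of which is
    settled by [commutator_hdual]. *)
Lemma contact_projective_field A : spo R l n A ->
  contact_fields R l n (projective_field A).
Proof.
move=> spoA; split=> [|T [VT T0]]; first exact: Vect_projective_field.
have VB := Vect_bracket (Vect_projective_field A) VT; split=> //.
rewrite (alphaE (Vect1 VB)) /bracket.
under eq_bigr => k _.
  rewrite sum_opE mulr_suml.
  under eq_bigr => p _ do rewrite sum_opE mulr_suml opart_projective_field.
  over.
rewrite exchange_big big1 // => p _; rewrite exchange_big big1 //= => q _.
have [_ /(_ q) dT] := VT.
apply: commutator_hdual => //.
- exact: homog_mxpart.
- by move=> k j; exact: spo_mxpart.
- exact: hcoord_hdual.
(* The part of [T] of parity [q] inherits tangency from [T]. *)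
by rewrite -(alphaE (superderivation1 dT)) alpha_opart // T0 raddf0.
Qed.

End ContactFields.

Local Open Scope classical_set_scope.

Theorem mainTheorem5 (R : realType) (l n : nat) (n_ge1 : (1 <= n)%N) :
  @Phi R (l + (1 + l)) n @` (@spo_to_pgl R l n @` spo R l n) `<=`
  contact_fields R l n `&`
    (@Phi R (l + (1 + l)) n @` [set: pgl R (l + (1 + l)) n]).
Proof.
move=> _ [_ [A spoA <-] <-]; split; last by exists (spo_to_pgl A).
by rewrite /spo_to_pgl Phi_pgl_class; exact: contact_projective_field.
Qed.
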